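(* Let $K$ be an algebraic number field, $X$ its set of places, $S$ a finite subset of $X$ containing all Archimedean places, $\Omega_S=X\setminus S$, and \[ {\mathbb{A}}_{K,S}=\prod_{\upsilon\in S}K_\upsilon\times\prod_{\upsilon\in\Omega_S}\mathfrak{o}_\upsilon . \] The prime ideals of ${\mathbb{A}}_{K,S}$ are exactly the following. \begin{enumerate} \item For $\upsilon_0\in X$, the set $M^{(0)}_{S,\upsilon_0}=\{\alpha\in{\mathbb{A}}_{K,S}\mid \alpha_{\upsilon_0}=0\}$. It is a prime ideal which is both maximal and minimal if $\upsilon_0\in S$, and minimal but not maximal if $\upsilon_0\in\Omega_S$. It is the principal ideal generated by the element $\alpha$ with $\alpha_{\upsilon_0}=0$ and $\alpha_\upsilon$ a unit of the $\upsilon$-th factor ($K_\upsilon^\times$ if $\upsilon\in S$, $\mathfrak{o}_\upsilon^\times$ if $\upsilon\in\Omega_S$) for every $\upsilon\neq\upsilon_0$. \item For $\upsilon_0\in\Omega_S$, the set $M^{\mathfrak{m}}_{S,\upsilon_0}=\{\alpha\in{\mathbb{A}}_{K,S}\mid \alpha_{\upsilon_0}\in\mathfrak{m}_{\upsilon_0}\}$, which is a maximal ideal, generated by the element $\alpha$ with $\alpha_{\upsilon_0}$ a generator of $\mathfrak{m}_{\upsilon_0}$ and $\alpha_\upsilon$ a unit of the $\upsilon$-th factor for every $\upsilon\neq\upsilon_0$. \item For a non-principal ultrafilter $\mathcal{U}$ on $\Omega_S$, the maximal ideal \[M^{\mathfrak{m}}_{S,\mathcal{U}}=\{\alpha\in{\mathbb{A}}_{K,S}\mid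 \{\upsilon\in\Omega_S\mid \alpha_\upsilon\in\mathfrak{m}_\upsilon\}\in\mathcal{U}\}\] and the minimal prime ideal \[M^{(0)}_{S,\mathcal{U}}=\{\alpha\in{\mathbb{A}}_{K,S}\mid \{\upsilon\in\Omega_S\mid \alpha_\upsilon=0\}\in\mathcal{U}\};\] neither of these is a principal ideal. \item If $\mathfrak{p}$ is any prime ideal of ${\mathbb{A}}_{K,S}$ not among those listed in (1)–(3), then there is exactly one non-principal ultrafilter $\mathcal{U}$ on $\Omega_S$ with $\mathfrak{p}\subseteq M^{\mathfrak{m}}_{S,\mathcal{U}}$, one has $\mathfrak{p}=\bigcup_{\beta\in\mathfrak{p}}\mathfrak{p}^\beta_{S,\mathcal{U}}$, where \[\mathfrak{p}^\beta_{S,\mathcal{U}}=\{\alpha\in{\mathbb{A}}_{K,S}\mid \exists\,Y\in\mathcal{U},\ \exists\, n\in\mathbb{N}_{\ge1}\text{ such that } \upsilon(\alpha_\upsilon^n)\ge\upsilon(\beta_\upsilon)\ \forall\upsilon\in Y\},\] and $\mathfrak{p}$ is not a principal ideal. \end{enumerate}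
   Context: For each place $\upsilon$ of $K$, $K_\upsilon$ is the completion of $K$ at $\upsilon$; for a non-Archimedean place $\upsilon$, $\mathfrak{o}_\upsilon$ is its valuation ring with maximal ideal $\mathfrak{m}_\upsilon$, and $\upsilon$ also denotes the normalized discrete valuation $K_\upsilon\to\mathbb{Z}\cup\{\infty\}$ with $\upsilon(0)=\infty$. Elements of ${\mathbb{A}}_{K,S}$ are written $\alpha=(\alpha_\upsilon)_{\upsilon\in X}$. An ultrafilter on a set $\Omega$ is a nonempty family $\mathcal{U}$ of subsets of $\Omega$ with $\emptyset\notin\mathcal{U}$, closed under finite intersections and supersets, and such that for every $A\subseteq\Omega$ either $A$ or $\Omega\setminus A$ lies in $\mathcal{U}$. It is principal (generated by $\omega_0$) if it consists of all subsets containing a fixed point $\omega_0$, and non-principal otherwise. *)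

(* Defs.v *)
From HB Require Import structures.
From mathcomp Require Import all_boot all_order all_algebra fieldext.
From mathcomp Require Import all_classical reals constructive_ereal exp.
From mathcomp Require Import lra.
Set Implicit Arguments.
Unset Strict Implicit.
Unset Printing Implicit Defensive.
Import Order.TTheory GRing.Theory Num.Theory.
Local Open Scope classical_set_scope.
Local Open Scope ring_scope.

(* Ideals are classical sets rather than the [{pred A}] of ring_quotient, which
   requires 1 != 0 from the type: that the ring below is nonzero rests on the
   existence of a place. *)
Section Ideals.
Variable A : comPzRingType.
Implicit Types I J : set A.

Definition ideal I :=
  [/\ I 0, (forall x y, I x -> I y -> I (x + y)) &
      (forall a x, I x -> I (a * x))].

Definition proper_ideal I := ideal I /\ ~ I 1.

Definition prime_ideal I :=
  proper_ideal I /\ (forall x y, I (x * y) -> I x \/ I y).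

Definition maximal_ideal I :=
  proper_ideal I /\ (forall J, proper_ideal J -> I `<=` J -> J = I).

Definition minimal_prime_ideal I :=
  prime_ideal I /\ (forall J, prime_ideal J -> J `<=` I -> J = I).

Definition ideal_gen (a : A) : set A := [set r * a | r in [set: A]].

Definition principal_ideal I := exists a, I = ideal_gen a.

End Ideals.

Section Ultrafilters.
Variable T : Type.
Implicit Type U : set_system T.

Definition ultrafilter U := ProperFilter U /\ (forall A, U A \/ U (~` A)).

Definition nonprincipal_ultrafilter U :=
  ultrafilter U /\ ~ (exists w, U = principal_filter w).

End Ultrafilters.

Section AbsoluteValues.
Variables (R : realType) (F : fieldType).
Implicit Types a b : F -> R.

Definition absval a :=
  [/\ (forall x, 0 <= a x), (forall x, a x = 0 <-> x = 0),
      (forall x y, a (x * y) = a x * a y) &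
      (forall x y, a (x + y) <= a x + a y)].

Definition nontrivial_absval a := absval a /\ (exists2 x, x != 0 & a x != 1).

Definition ultrametric a := forall x y, a (x + y) <= Num.max (a x) (a y).

Definition absval_equiv a b :=
  exists2 s : R, 0 < s & forall x, b x = a x `^ s.

Definition absval_cauchy a (u : nat -> F) :=
  forall e : R, 0 < e ->
    exists N, forall m n, (N <= m)%N -> (N <= n)%N -> a (u m - u n) < e.

Definition absval_cvg a (u : nat -> F) (l : F) :=
  forall e : R, 0 < e -> exists N, forall n, (N <= n)%N -> a (u n - l) < e.

Lemma absval1 a : absval a -> a 1 = 1.
Proof.
case=> _ eq0 mul _; have /eqP := mul 1 1.
rewrite mulr1 -subr_eq0 -{1}[a 1]mulr1 -mulrBr.
rewrite mulf_eq0 => /orP[/eqP/eq0/eqP|]; first by rewrite oner_eq0.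
by rewrite subr_eq0 => /eqP.
Qed.

Lemma absvalN a x : absval a -> a (- x) = a x.
Proof.
move=> aP; have [ge0 _ mul _] := aP.
suff n1 : a (- 1) = 1 by rewrite -mulN1r mul n1 mul1r.
have /eqP := mul (-1) (-1).
rewrite mulrNN mulr1 absval1 // -expr2 eq_sym sqrf_eq1 => /orP[/eqP//|/eqP nn].
by have := ge0 (-1); rewrite nn ler0N1.
Qed.

End AbsoluteValues.

Record place (R : realType) (K : fieldType) := Place {
  place_class : set (K -> R);
  place_classP : exists2 a, nontrivial_absval a &
    place_class = [set b | absval b /\ absval_equiv a b]
}.

Definition archimedean_place (R : realType) (K : fieldType) :
    set (place R K) :=
  [set v | exists2 a, place_class v a & ~ ultrametric a].

(* [cabs] is any absolute value that induces on K a member of the class v;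
   [valring], [valideal] and [normval] do not depend on which one. *)
Record completion (R : realType) (K : fieldType) (v : place R K) :=
  Completion {
    cfield :> fieldType;
    cembed : {rmorphism K -> cfield};
    cabs : cfield -> R;
    cabs_absval : absval cabs;
    cabs_place : place_class v (cabs \o cembed);
    cembed_dense : forall (x : cfield) (e : R), 0 < e ->
      exists k, cabs (x - cembed k) < e;
    cabs_complete : forall u : nat -> cfield,
      absval_cauchy cabs u -> exists l, absval_cvg cabs u l
  }.

Section LocalField.
Variables (R : realType) (K : fieldType) (v : place R K) (L : completion v).

Definition valring : set L := [set x | cabs x <= 1].

Definition valideal : set L := [set x | cabs x < 1].

(* [\bar int] serves as Z together with an element +oo; -oo is never a value. *)
Definition normalized_valuation (nu : L -> \bar int) :=
  [/\ (forall x, nu x = +oo%E <-> x = 0) /\ (forall x, nu x != -oo%E),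
      (forall x y, (nu (x * y)%R = nu x + nu y)%E),
      (forall x y, (Order.min (nu x) (nu y) <= nu (x + y)%R)%E),
      (forall n : int, exists x, nu x = n%:E) &
      (forall x, (0 <= nu x)%E <-> valring x)].

(* The conditions above determine nu; the default value is not used at the
   non-Archimedean places of a number field, where such a nu exists. *)
Definition normval : L -> \bar int :=
  xget (fun=> +oo%E) [set nu | normalized_valuation nu].

Definition valideal_generator (p : L) :=
  valideal = [set p * y | y in valring].

Lemma cabs_ultrametric : ~ archimedean_place v -> ultrametric (@cabs _ _ _ L).
Proof.
move=> nav; have uK : ultrametric (@cabs _ _ _ L \o cembed L).
  by apply: contrapT => nu; apply: nav; exists (cabs (c:=L) \o cembed L) => //;
     exact: cabs_place.
have [_ _ _ tri] := cabs_absval L.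
have absN (x : L) : cabs (- x) = cabs x by exact/absvalN/cabs_absval.
move=> x y; apply/ler_addgt0Pr => e e0.
have e3 : 0 < e / 3 by lra.
have [k hk] := cembed_dense x e3; have [l hl] := cembed_dense y e3.
have hxy : cabs (x + y) <= cabs (x - cembed L k) + cabs (y - cembed L l)
                           + cabs (cembed L (k + l)).
  rewrite rmorphD /=.
  have -> : x + y = (x - cembed L k) + (y - cembed L l)
                    + (cembed L k + cembed L l) by rewrite addrACA !subrK.
  by apply: le_trans (tri _ _) _; rewrite lerD2r.
have hu : cabs (cembed L (k + l)) <= Num.max (cabs x) (cabs y) + e / 3.
  apply: le_trans (uK k l) _ => /=; rewrite ge_max.
  have hk' : cabs (cembed L k) <= cabs x + e / 3.
    rewrite -[cembed L k](subKr x); apply: le_trans (tri _ _) _.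
    by rewrite absN lerD2l ltW.
  have hl' : cabs (cembed L l) <= cabs y + e / 3.
    rewrite -[cembed L l](subKr y); apply: le_trans (tri _ _) _.
    by rewrite absN lerD2l ltW.
  by apply/andP; split; [apply: le_trans hk' _ | apply: le_trans hl' _];
     rewrite lerD2r le_max lexx ?orbT.
lra.
Qed.

Lemma valring_subring : ~ archimedean_place v ->
  [/\ valring 1, (forall x y, valring x -> valring y -> valring (x - y)) &
      (forall x y, valring x -> valring y -> valring (x * y))].
Proof.
move=> /cabs_ultrametric uL; have aP := cabs_absval L.
have [ge0 eq0 mul _] := aP.
rewrite /valring /=; split=> [|x y hx hy|x y hx hy]; first by rewrite absval1.
  apply: le_trans (uL _ _) _; by rewrite ge_max absvalN ?hx.
by rewrite mul mulr_ile1.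
Qed.

End LocalField.

Arguments valring {R K v} L.
Arguments valideal {R K v} L.
Arguments normval {R K v} L.

Section DependentProductRing.
Variables (I : Type) (F : I -> comPzRingType).

Definition prod_ring := forall i, F i.

HB.instance Definition _ := gen_eqMixin prod_ring.
HB.instance Definition _ := gen_choiceMixin prod_ring.

Implicit Types f g h : prod_ring.
Let padd f g : prod_ring := fun i => f i + g i.
Let popp f : prod_ring := fun i => - f i.
Let pmul f g : prod_ring := fun i => f i * g i.

Let paddA : associative padd.
Proof. by move=> f g h; apply: functional_extensionality_dep => i; rewrite /padd addrA. Qed.
Let paddC : commutative padd.
Proof. by move=> f g; apply: functional_extensionality_dep => i; rewrite /padd addrC. Qed.
Let padd0 : left_id (fun i => 0 : F i) padd.
Proof. by move=> f; apply: functional_extensionality_dep => i; rewrite /padd add0r. Qed.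
Let paddN : left_inverse (fun i => 0 : F i) popp padd.
Proof. by move=> f; apply: functional_extensionality_dep => i; rewrite /padd addNr. Qed.

HB.instance Definition _ :=
  GRing.isZmodule.Build prod_ring paddA paddC padd0 paddN.

Let pmulA : associative pmul.
Proof. by move=> f g h; apply: functional_extensionality_dep => i; rewrite /pmul mulrA. Qed.
Let pmulC : commutative pmul.
Proof. by move=> f g; apply: functional_extensionality_dep => i; rewrite /pmul mulrC. Qed.
Let pmul1 : left_id (fun i => 1 : F i) pmul.
Proof. by move=> f; apply: functional_extensionality_dep => i; rewrite /pmul mul1r. Qed.
Let pmulD : left_distributive pmul +%R.
Proof. by move=> f g h; apply: functional_extensionality_dep => i; rewrite /pmul mulrDl. Qed.

HB.instance Definition _ :=
  GRing.Zmodule_isComPzRing.Build prod_ring pmulA pmulC pmul1 pmulD.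

End DependentProductRing.

Section SAdeles.
Variables (R : realType) (K : fieldType).
Variable Kv : forall v : place R K, completion v.
Variable S : set (place R K).

Definition factor (v : place R K) : set (Kv v) :=
  [set x | S v \/ valring (Kv v) x].

Definition factor_unit (v : place R K) (x : Kv v) :=
  factor x /\ (exists2 y, factor y & x * y = 1).

(* The hypothesis is an argument of the type because it makes the ring
   structure well defined: [valring] is a ring at non-Archimedean places only. *)
Record adele (archS : @archimedean_place R K `<=` S) := Adele {
  coord :> forall v, Kv v;
  coordP : `[< forall v, factor (coord v) >]
}.

End SAdeles.

Section SAdeleRing.
Variables (R : realType) (K : fieldType).
Variable Kv : forall v : place R K, completion v.
Variables (S : set (place R K)) (archS : @archimedean_place R K `<=` S).

Local Notation P := (prod_ring (fun v => Kv v : comPzRingType)).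
Local Notation A := (adele Kv archS).

Let integral : {pred P} := fun f => `[< forall v, factor S (f v) >].

HB.instance Definition _ := [isSub of A for (@coord R K Kv S archS : A -> P)].
HB.instance Definition _ := [Choice of A by <:].

Let integral_subring : subring_closed integral.
Proof.
have nonarch v : ~ S v -> ~ archimedean_place v by move=> nSv /archS.
split.
- apply/asboolP => v; have [Sv|nSv] := pselect (S v); first by left.
  by right; have [] := valring_subring (Kv v) (nonarch _ nSv).
- move=> f g /asboolP hf /asboolP hg; apply/asboolP => v.
  have [Sv|nSv] := pselect (S v); first by left.
  have [_ hB _] := valring_subring (Kv v) (nonarch _ nSv).
  by right; case: (hf v) => // hfv; case: (hg v) => // hgv; exact: hB.
- move=> f g /asboolP hf /asboolP hg; apply/asboolP => v.
  have [Sv|nSv] := pselect (S v); first by left.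
  have [_ _ hM] := valring_subring (Kv v) (nonarch _ nSv).
  by right; case: (hf v) => // hfv; case: (hg v) => // hgv; exact: hM.
Qed.

HB.instance Definition _ :=
  GRing.SubChoice_isSubComPzRing.Build P integral A integral_subring.

End SAdeleRing.

Section Primes.
Variables (R : realType) (K : fieldType).
Variable Kv : forall v : place R K, completion v.
Variables (S : set (place R K)) (archS : @archimedean_place R K `<=` S).

Local Notation A := (adele Kv archS).

Definition M0 (v0 : place R K) : set A := [set a | a v0 = 0].

Definition Mm (v0 : place R K) : set A := [set a | valideal (Kv v0) (a v0)].

Definition M0U (U : set_system (~` S)) : set A :=
  [set a | U [set v | a (val v) = 0]].

Definition MmU (U : set_system (~` S)) : set A :=
  [set a | U [set v | valideal (Kv (val v)) (a (val v))]].

Definition p_beta (U : set_system (~` S)) (b : A) : set A :=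
  [set a | exists2 Y, U Y & exists2 n, (1 <= n)%N & forall v, Y v ->
     (normval (Kv (val v)) (b (val v))
        <= normval (Kv (val v)) (a (val v) ^+ n))%E].

Definition listed_prime (p : set A) :=
  [\/ (exists v0, p = M0 v0),
      (exists2 v0, ~ S v0 & p = Mm v0) |
      (exists2 U, nonprincipal_ultrafilter U & p = MmU U \/ p = M0U U)].

End Primes.

Arguments M0 {R K} Kv {S} archS v0.
Arguments Mm {R K} Kv {S} archS v0.
Arguments M0U {R K} Kv {S} archS U.
Arguments MmU {R K} Kv {S} archS U.
Arguments archimedean_place {R K}.

(* Main.v *)
Require Import Defs.
From mathcomp Require Import all_boot all_order all_algebra fieldext.
From mathcomp Require Import all_classical reals.
From mathcomp Require Import falgebra constructive_ereal exp.
Set Implicit Arguments.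
Unset Strict Implicit.
Unset Printing Implicit Defensive.
Import Order.TTheory GRing.Theory Num.Theory.
Local Open Scope classical_set_scope.
Local Open Scope ring_scope.

(* The idempotents of the ring are the indicators [idem Y] of sets of places. A
   prime ideal p contains exactly one of [idem Y] and [idem (~` Y)], so the sets
   Y with [idem (~` Y)] in p form an ultrafilter V on the set of all places. If V
   is principal at v0, then p is pulled back from the v0-th factor, a field or a
   discrete valuation ring. Otherwise V contains the complement of the finite
   set S, and p lies between the minimal prime {a | a_v = 0 V-almost everywhere}
   and the maximal ideal {a | a_v in m_v V-almost everywhere}. Membership in an
   ideal that contains [idem (~` Y)] only has to be tested on Y, where it reduces
   to divisibility factor by factor.
   Discreteness of a non-Archimedean absolute value of K: its value group on Q is
   generated by some |p|, and since the powers of x in K are linearly dependent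
   over Q, two terms of a relation have the same absolute value; hence |x|^n! is
   a power of |p|, where n is the degree of K. *)

(** * Absolute values and the ultrametric inequality *)

Section AbsvalTheory.
Variables (R : realType) (F : fieldType) (a : F -> R).
Hypothesis aP : absval a.

Lemma absval_ge0 x : 0 <= a x. Proof. by case: aP => h _ _ _. Qed.

Lemma absvalM x y : a (x * y) = a x * a y. Proof. by case: aP => _ _ h _. Qed.

Lemma absval0 : a 0 = 0. Proof. by case: aP => _ h _ _; apply/h. Qed.

Lemma absval_eq0 x : (a x == 0) = (x == 0).
Proof. by case: aP => _ h _ _; apply/eqP/eqP => /h. Qed.

Lemma absval_gt0 x : (0 < a x) = (x != 0).
Proof. by rewrite lt0r absval_eq0 absval_ge0 andbT. Qed.

Lemma absvalV x : a x^-1 = (a x)^-1.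
Proof.
have [->|x0] := eqVneq x 0; first by rewrite invr0 absval0 invr0.
have ax0 : a x != 0 by rewrite absval_eq0.
by apply: (mulfI ax0); rewrite -absvalM !mulfV // absval1.
Qed.

Lemma absvalX x n : a (x ^+ n) = a x ^+ n.
Proof.
by elim: n => [|n IHn]; rewrite ?expr0 ?absval1 // !exprS absvalM IHn.
Qed.

Lemma absvalXz x (k : int) : a (x ^ k) = a x ^ k.
Proof. by case: k => n; rewrite ?NegzE -?exprnN ?absvalV -?exprnP absvalX. Qed.

Hypothesis aU : ultrametric a.

(** Otherwise [x = (x + y) - y] would be a sum of two terms smaller than [x]. *)
Lemma ultrametric_addl x y : a y < a x -> a (x + y) = a x.
Proof.
move=> yx; apply/le_anti/andP; split.
  by apply: le_trans (aU _ _) _; rewrite ge_max lexx ltW.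
have := aU (x + y) (- y); rewrite addrK le_max (absvalN y aP) => /orP[//|].
by rewrite leNgt yx.
Qed.

Lemma ultrametric_sum_lt (I : finType) (P : pred I) (f : I -> F) e :
  0 < e -> (forall i, P i -> a (f i) < e) -> a (\sum_(i | P i) f i) < e.
Proof.
move=> e0 fe; elim/big_ind: _ => [|x y xe ye|i /fe//]; first by rewrite absval0.
by apply: le_lt_trans (aU _ _) _; rewrite gt_max xe.
Qed.

(** A term strictly larger than all the others would give the whole sum its absolute value, so the
    maximum is attained twice. *)
Lemma ultrametric_sum0 (I : finType) (f : I -> F) :
  \sum_i f i = 0 -> (exists i, f i != 0) ->
  exists i j, [/\ i != j, f i != 0 & a (f i) = a (f j)].
Proof.
move=> f0 [i0 fi0]; case: (@arg_maxP _ _ _ i0 xpredT (a \o f)) => // i _ /= fi.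
have ai0 : 0 < a (f i) by apply: lt_le_trans (fi i0 isT); rewrite absval_gt0.
have [/existsP[j /andP[ij /eqP aij]]|/existsPn nj] :=
  boolP [exists j, (i != j) && (a (f i) == a (f j))].
  by exists i, j; split=> //; rewrite -absval_gt0.
have : a (\sum_(j | j != i) f j) < a (f i).
  apply: ultrametric_sum_lt => // j ji; rewrite lt_neqAle fi// andbT.
  by have := nj j; rewrite eq_sym ji /= eq_sym.
have fi_sum : f i + \sum_(j | j != i) f j = 0 by move: f0; rewrite (bigD1 i).
by move/ultrametric_addl; rewrite fi_sum absval0 => ai; rewrite -ai ltxx in ai0.
Qed.

Lemma ultrametric_natr n : a n%:R <= 1.
Proof.
elim: n => [|n IHn]; first by rewrite absval0 ler01.
by rewrite -natr1; apply: le_trans (aU _ _) _; rewrite ge_max IHn absval1 /=.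
Qed.

(* [p] is the least positive integer with [a p%:R < 1], or 1 if there is none;
   such an integer divides every [n] with [a n%:R < 1]. *)
Lemma ultrametric_natr_exp : exists2 p, (0 < p)%N &
  forall n, (0 < n)%N -> exists k : nat, a n%:R = a p%:R ^+ k.
Proof.
have [ex|nex] := pselect (exists n, (0 < n)%N && (a n%:R < 1)); last first.
  exists 1 => // n n0; exists 0; apply/eqP; rewrite expr0 eq_le ultrametric_natr.
  by rewrite leNgt; apply/negP => an; apply: nex; exists n; rewrite n0.
case: (ex_minnP ex) => p /andP[p0 ap] minp; exists p => //.
elim/ltn_ind => n IHn n0; have [pn|npn] := boolP (p %| n)%N; last first.
  exists 0; rewrite expr0; apply/eqP; rewrite eq_le ultrametric_natr leNgt.
  (* The remainder of [n] modulo [p] would be a smaller positive integer of absolute value less than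
     1. *)
  apply/negP => an; have /minp : (0 < n %% p)%N && (a (n %% p)%:R < 1).
    rewrite lt0n -/(dvdn p n) npn /=.
    have -> : (n %% p)%:R = n%:R - (n %/ p)%:R * p%:R :> F.
      by rewrite {2}(divn_eq n p) natrD natrM addrAC subrr add0r.
    apply: le_lt_trans (aU _ _) _; rewrite gt_max an (absvalN _ aP) absvalM.
    by apply: le_lt_trans ap; rewrite ler_piMl ?absval_ge0 ?ultrametric_natr.
  by rewrite leqNgt ltn_mod p0.
have p1 : (1 < p)%N.
  by rewrite ltn_neqAle p0 andbT; apply: contraTneq ap => <-; rewrite absval1 ?ltxx.
have := IHn (n %/ p)%N (ltn_Pdiv p1 n0); rewrite divn_gt0// dvdn_leq// => /(_ isT)[k ak].
by exists k.+1; rewrite -{1}(divnK pn) natrM absvalM ak exprSr.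
Qed.

End AbsvalTheory.

(** * Discreteness of non-Archimedean absolute values of a number field *)

Section NumberField.
Variables (R : realType) (K : fieldExtType rat) (a : K -> R).
Hypotheses (aP : absval a) (aU : ultrametric a).

Lemma natr_fieldExt_neq0 n : (0 < n)%N -> n%:R != 0 :> K.
Proof.
by move=> n0; rewrite -(rmorph_nat (in_alg K)) fmorph_eq0 pnatr_eq0 -lt0n.
Qed.

Lemma absval_rat_exp : exists2 p, (0 < p)%N &
  forall q : rat, q != 0 -> exists k : int, a (in_alg K q) = a p%:R ^ k.
Proof.
have [p p0 ap] := ultrametric_natr_exp aP aU; exists p => // q q0.
have int_exp (z : int) : z != 0 -> exists k : nat, a z%:~R = a p%:R ^+ k.
  move=> z0; have : (0 < `|z|)%N by rewrite absz_gt0.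
  move=> /ap[k kE]; exists k; rewrite -kE; case: (intP z) => [|n|n]//=.
  by rewrite rmorphN /= (absvalN _ aP).
have [k kE] : exists k : nat, a (numq q)%:~R = a p%:R ^+ k.
  by apply: int_exp; rewrite numq_eq0.
have [l lE] := int_exp (denq q) (denq_neq0 q).
exists (k%:Z - l%:Z); rewrite -[q in LHS]divq_num_den fmorph_div !rmorph_int.
rewrite (absvalM aP) (absvalV aP) kE lE expfzDr ?(absval_eq0 aP) ?natr_fieldExt_neq0//.
by rewrite exprnN.
Qed.

(* Some [m <= \dim K] is the exponent gap of two terms of the minimal polynomial
   of [x] that have the same absolute value. *)
Lemma absval_exp_fact : exists2 p, (0 < p)%N & forall x, x != 0 ->
  exists k : int, a x ^+ (\dim {:K})`! = a p%:R ^ k.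
Proof.
have [p p0 ap] := absval_rat_exp; exists p => // x x0.
have ap0 : a p%:R != 0 by rewrite absval_eq0// natr_fieldExt_neq0.
have /polyOver1P[q qE] := minPolyOver 1%AS x.
have szq : size q = (adjoin_degree 1%AS x).+1.
  by rewrite -(size_map_poly (in_alg K)) -qE size_minPoly.
have deg_le : (adjoin_degree 1%AS x <= \dim {:K})%N.
  by have := dim_Fadjoin 1%AS x; rewrite dimv1 muln1 => <-; rewrite dimvS ?subvf.
have q_nz : q != 0 by rewrite -size_poly_gt0 szq.
have sum0 : \sum_(i < size q) in_alg K q`_i * x ^+ i = 0.
  have := minPolyxx 1%AS x; rewrite qE horner_coef size_map_poly => qx.
  by rewrite -[RHS]qx; apply: eq_bigr => i _; rewrite coef_map.
(* The leading term of the minimal polynomial is the required nonzero term. *)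
have [|i [j [ij fi0 aij]]] := ultrametric_sum0 aP aU sum0.
  have sq : ((size q).-1 < size q)%N by rewrite szq.
  exists (Ordinal sq); apply: mulf_neq0; last exact: expf_neq0.
  by rewrite fmorph_eq0 -lead_coefE lead_coef_eq0.
wlog {ij} ltij : i j fi0 aij / (i < j)%N => [hwlog|].
  have [/hwlog|ji|/val_inj ijE] := ltngtP i j; first exact.
    by apply: (hwlog j i) => //; rewrite -(absval_eq0 aP) -aij absval_eq0.
  by rewrite ijE eqxx in ij.
have nz0 (t : 'I_(size q)) : in_alg K q`_t * x ^+ t != 0 -> q`_t != 0.
  by rewrite mulf_eq0 negb_or fmorph_eq0 => /andP[].
have fj0 : in_alg K q`_j * x ^+ j != 0 by rewrite -(absval_eq0 aP) -aij absval_eq0.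
have [k kE] := ap _ (nz0 _ fi0); have [l lE] := ap _ (nz0 _ fj0).
have am : a x ^+ (j - i) = a p%:R ^ (k - l).
  have aj0 : a p%:R ^ l * a x ^+ i != 0.
    by rewrite mulf_neq0 ?expfz_neq0// expf_neq0// absval_eq0.
  apply: (mulfI aj0); move: aij; rewrite !(absvalM aP) !(absvalX aP) kE lE.
  rewrite -mulrA -exprD subnKC ?(ltnW ltij)// => <-.
  by rewrite mulrAC -expfzDr// subrKC.
(* The gap [j - i] depends on [x] but is at most the degree of [K], so the factorial is an exponent
   that serves all [x] at once. *)
have /dvdnP[m ->] : (j - i %| (\dim {:K})`!)%N.
  apply: dvdn_fact; rewrite subn_gt0 ltij/=; apply: leq_trans deg_le.
  by rewrite -ltnS -szq (leq_ltn_trans (leq_subr _ _)).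
by exists ((k - l) * m%:Z); rewrite mulnC exprM am -exprz_exp -exprnP.
Qed.

(** All [N]-th powers of nonzero values are integral powers of one [c < 1]; an element that realizes
    the least positive exponent has the largest value below 1. *)
Lemma number_field_uniformizer : (exists2 x, x != 0 & a x != 1) ->
  exists pi, [/\ pi != 0, a pi < 1 & forall x, a x < 1 -> a x <= a pi].
Proof.
move=> [x0 x0_nz ax0]; have [p p_gt0 aexp] := absval_exp_fact.
set N := (_`!) in aexp; set c := a p%:R in aexp.
have N0 : (0 < N)%N by rewrite fact_gt0.
have c0 : 0 < c by rewrite absval_gt0 ?natr_fieldExt_neq0.
(* If [c] were 1, every nonzero value would have [N]-th power 1, against nontriviality. *)
have c1 : c < 1.
  rewrite lt_neqAle ultrametric_natr// andbT; apply: contra_neq ax0 => cE.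
  have [k] := aexp _ x0_nz; rewrite cE exp1rz => /eqP.
  by rewrite pexpr_eq1 ?absval_ge0// => /eqP.
pose P k := `[< (0 < k)%N /\ exists2 x, x != 0 & a x ^+ N = c ^+ k >].
have exP : exists k, P k.
  by exists N; apply/asboolP; split=> //; exists p%:R; rewrite ?natr_fieldExt_neq0.
case: (ex_minnP exP) => k /asboolP[k0 [pi pi0 pik]] mink; exists pi.
have XN := ltr_pXn2r N0; split=> // [|y y1].
  rewrite -(XN R) ?nnegrE ?absval_ge0// expr1n pik.
  by rewrite exprn_ilt1 ?ltW// -lt0n.
have [->|y0] := eqVneq y 0; first by rewrite absval0// absval_ge0.
have [z zE] := aexp _ y0.
have : a y ^+ N < 1 by rewrite exprn_ilt1 ?absval_ge0// -lt0n.
rewrite -(ler_pXn2r N0) ?nnegrE ?absval_ge0// pik zE.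
(* An exponent that is negative or zero would make [a y] at least 1. *)
case: z zE => [j|j] zE; last first.
  by rewrite NegzE -exprnN invf_lt1 ?exprn_gt0// ltNge exprn_ile1// ltW.
have [->|j0] := posnP j; first by rewrite ltxx.
move=> _; rewrite -exprnP ler_iXn2l//; apply: mink; apply/asboolP; split=> //.
by exists y.
Qed.

End NumberField.

(** * Uniformizers and normalized valuations of the completions *)

Section LocalField.
Variables (R : realType) (K : fieldExtType rat) (v : place R K) (L : completion v).
Hypothesis nav : ~ archimedean_place v.

Let cP := cabs_absval L.
Let cU := cabs_ultrametric (L:=L) nav.

(** Completion adds no new values: an element of [K] within distance [cabs x] of a nonzero [x] has
    the same absolute value as [x]. A uniformizer of [K] therefore remains one in [L]. *)
Lemma local_field_uniformizer : exists pi : L,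
  [/\ pi != 0, cabs pi < 1 & forall x : L, cabs x < 1 -> cabs x <= cabs pi].
Proof.
pose b := @cabs _ _ _ L \o cembed L.
have bP : absval b.
  have [ge0 eq0 mul tri] := cP; split=> [x|x|x y|x y]; rewrite /b/= ?rmorphM ?rmorphD//=.
  by split=> [/eq0/eqP|->]; [rewrite fmorph_eq0 => /eqP|rewrite rmorph0; apply/eq0].
have bU : ultrametric b by move=> x y; rewrite /b/= rmorphD.
(* [b] is a positive power of a nontrivial representative of the place. *)
have b_nontriv : exists2 x, x != 0 & b x != 1.
  have [a0 [aP [x x0 ax]] vE] := place_classP v.
  have := cabs_place L; rewrite vE => -[_ [s s0 bE]]; exists x => //.
  by rewrite [b x]bE powR_eq1 !negb_or ax gt_eqF// -leNgt absval_ge0.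
have [pi [pi0 pi1 pimax]] := number_field_uniformizer bP bU b_nontriv.
exists (cembed L pi); split=> [|//|x x1]; first by rewrite fmorph_eq0.
have [->|x0] := eqVneq x 0; first by rewrite (absval0 cP) absval_ge0.
have [k xk] := cembed_dense x (etrans (absval_gt0 cP x) x0).
have xE : cabs x = cabs (cembed L k).
  have := @ultrametric_addl _ _ _ cP cU x (cembed L k - x).
  by rewrite subrKC -[cembed L k - x]opprB (absvalN _ cP) => /(_ xk).
by rewrite xE; apply: pimax; rewrite /b /= -xE.
Qed.

Lemma valideal_generator_exists : exists pi : L, valideal_generator pi.
Proof.
have [pi [pi0 pi1 pimax]] := local_field_uniformizer; exists pi.
apply/seteqP; split=> x /=; rewrite /valideal /valring /=.
  move=> /pimax xpi; exists (x / pi); last by rewrite mulrCA mulfV ?mulr1.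
  by rewrite /= (absvalM cP) (absvalV cP) ler_pdivrMr ?mul1r// (absval_gt0 cP).
case=> y /= y1 <-; rewrite (absvalM cP); apply: le_lt_trans pi1.
by rewrite ler_piMr// (absval_ge0 cP).
Qed.

(** With [k] the floor of [ln |x| / ln |pi|], the value of [x / pi ^ k] lies in the interval from
    [|pi|], excluded, to 1, included. No value lies strictly between, so it is 1. *)
Lemma local_field_value_group (pi x : L) :
    pi != 0 -> cabs pi < 1 -> (forall x : L, cabs x < 1 -> cabs x <= cabs pi) ->
  x != 0 -> exists k : int, cabs x = cabs pi ^ k.
Proof.
move=> pi0 pi1 pimax x0.
have [cpi cx] : 0 < cabs pi /\ 0 < cabs x by rewrite !(absval_gt0 cP).
have ln_pi : ln (cabs pi) < 0 by rewrite ln_lt0// cpi.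
pose t := ln (cabs x) / ln (cabs pi); exists (Num.floor t).
have ln_exp (k : int) : ln (cabs pi ^ k) = k%:~R * ln (cabs pi).
  case: k => n; first by rewrite -exprnP lnXn// mulr_natl.
  by rewrite NegzE -exprnN lnV ?posrE ?exprn_gt0// lnXn// rmorphN /= mulNr mulr_natl.
have gt0_exp (k : int) : 0 < cabs pi ^ k by rewrite exprz_gt0.
have tE : ln (cabs x) = t * ln (cabs pi) by rewrite divfK// lt_eqF.
have /andP[le_t lt_t] := floor_itv t.
pose y := x / pi ^ Num.floor t.
have yE : cabs y = cabs x / cabs pi ^ Num.floor t.
  by rewrite (absvalM cP) (absvalV cP) (absvalXz cP).
suff : cabs y = 1 by rewrite yE => /divr1_eq.
apply/eqP; rewrite eq_le leNgt; apply/andP; split.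
  rewrite -leNgt yE ler_pdivrMr// mul1r -ler_ln ?posrE// tE ln_exp.
  by rewrite ler_nM2r.
rewrite leNgt; apply/negP => /pimax; apply/negP; rewrite -ltNge yE ltr_pdivlMr//.
by rewrite -{1}(expr1z (cabs pi)) -expfzDr ?gt_eqF// -ltr_ln ?posrE// tE ln_exp ltr_nM2r// addrC.
Qed.

Lemma normalized_valuation_exists : exists nu : L -> \bar int, normalized_valuation nu.
Proof.
have [pi [pi0 pi1 pimax]] := local_field_uniformizer.
have cpi : 0 < cabs pi by rewrite (absval_gt0 cP).
(* The exponent at 0 is a placeholder; the valuation built below sends 0 to [+oo]. *)
have [w wE] : {w : L -> int & forall x, x != 0 -> cabs x = cabs pi ^ w x}.
  apply: (@choice L int (fun x k => x != 0 -> cabs x = cabs pi ^ k)) => x.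
  have [->|x0] := eqVneq x 0; first by exists 0.
  by have [k kE] := local_field_value_group pi0 pi1 pimax x0; exists k.
have exp_le (k l : int) : (cabs pi ^ k <= cabs pi ^ l) = (l <= k).
  have expV (m : int) : cabs pi ^ m = (cabs pi)^-1 ^ (- m) by rewrite exprz_inv opprK.
  by rewrite (expV k) (expV l) ler_eXz2l ?lerN2// invf_gt1.
have w_uniq x k : x != 0 -> cabs x = cabs pi ^ k -> w x = k.
  move=> /wE -> e; apply/le_anti; rewrite -!exp_le e.
  by rewrite lexx.
exists (fun x => if x == 0 then +oo%E else (w x)%:E); split.
- by split=> x; case: (x =P 0) => // x0; split.
- move=> x y; rewrite mulf_eq0; have [->|x0] := eqVneq x 0.
    by case: eqP.
  have [->//|y0] := eqVneq y 0.
  rewrite /= -EFinD; congr (_%:E); apply: w_uniq; rewrite ?mulf_neq0//.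
  by rewrite (absvalM cP) expfzDr ?gt_eqF// -!wE.
- move=> x y; have [->|x0] := eqVneq x 0; first by rewrite add0r ge_min lexx orbT.
  have [->|y0] := eqVneq y 0; first by rewrite addr0 (negbTE x0) ge_min lexx.
  have [xy0|xy0] := eqVneq (x + y) 0; first by rewrite leey.
  by rewrite ge_min !lee_fin -!exp_le -!wE// -le_max.
- move=> n; exists (pi ^ n); rewrite expfz_eq0 (negbTE pi0) andbF.
  by congr (_%:E); apply: w_uniq; rewrite ?expfz_neq0// (absvalXz cP).
- move=> x; rewrite /valring /=; have [->|x0] := eqVneq x 0.
    by rewrite (absval0 cP) ler01 leey.
  by rewrite lee_fin (wE x)// -[X in _ <-> is_true (_ <= X)](expr0z (cabs pi)) exp_le.
Qed.

(** This turns the inequalities in [p_beta] into divisibility in the valuation ring, with 0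
    included. *)
Lemma normval_le (x y : L) :
  (normval L x <= normval L y)%E <-> exists2 z, valring L z & y = x * z.
Proof.
(* [normval] is chosen by [xget], so it has the required properties as soon as some normalized
   valuation exists. *)
have [[nu0 nuNy] nuM nuD nu_surj nu_ge0] : normalized_valuation (normval L).
  have [nu nuP] := normalized_valuation_exists.
  exact: (@xgetPex _ (fun=> +oo%E) [set nu | normalized_valuation nu]) (ex_intro _ nu nuP).
have [->|x0] := eqVneq x 0.
  have -> : normval L 0 = +oo%E by apply/nu0.
  rewrite leye_eq; split=> [/eqP/nu0 ->|[z _ ->]]; last by rewrite mul0r; apply/eqP/nu0.
  by exists 0; rewrite ?mul0r// /valring /= (absval0 cP) ler01.
have nux : normval L x \is a fin_num.
  by rewrite fin_numE nuNy; apply/eqP => /nu0/eqP; apply/negP.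
split=> [xy|[z /nu_ge0 z0 ->]]; last by rewrite nuM leeDl.
exists (y / x); last by rewrite mulrCA mulfV ?mulr1.
apply/nu_ge0; rewrite -(@leeD2lE _ (normval L x))// adde0 -nuM.
by rewrite mulrCA mulfV ?mulr1.
Qed.

End LocalField.

(** * General facts on ultrafilters *)

Section Ultrafilters.
Context {T : Type}.
Implicit Types (V : set_system T) (Y : set T).

Lemma ultrafilter_setC V Y : ultrafilter V -> V (~` Y) <-> ~ V Y.
Proof.
move=> [VP VC]; split=> [VnY VY|nVY]; last by case: (VC Y).
by apply: (@filter_not_empty _ V); rewrite -(setICr Y); apply: filterI.
Qed.

(** A set missing from [V] has its complement in [V], hence in [V'], and so is missing from [V']. *)
Lemma ultrafilter_sub_eq V V' :
  ultrafilter V -> ultrafilter V' -> V `<=` V' -> V = V'.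
Proof.
move=> UV UV' VV'; apply/seteqP; split=> // Y V'Y; apply: contrapT.
by move=> /(ultrafilter_setC _ UV)/VV'/(ultrafilter_setC _ UV').
Qed.

Lemma ultrafilter_principal (w : T) : ultrafilter (principal_filter w).
Proof.
split=> [|Y]; first exact: principal_filter_proper.
by have [Yw|nYw] := pselect (Y w); [left|right]; apply/principal_filterP.
Qed.

Lemma ultrafilter_set1 V (w : T) : ultrafilter V -> V [set w] -> V = principal_filter w.
Proof.
move=> UV Vw; apply/esym/ultrafilter_sub_eq => //; first exact: ultrafilter_principal.
by have [VP _] := UV; move=> Y /principal_filterP Yw; apply: filterS Vw => _ ->.
Qed.

End Ultrafilters.

Lemma ultrafilter_finite (T : Type) (V : set_system T) (S : set T) :
  ultrafilter V -> (forall w, ~ V [set w]) -> finite_set S -> V (~` S).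
Proof.
(* Enumerating a finite set by a sequence requires a choice structure on [T], supplied
   classically. *)
elim/Pchoice: T => T in V S *; move=> UV npV; have [VP _] := UV.
move=> /finite_seqP[s ->]; elim: s => [|x s IHs].
  by apply: filterS (@filterT _ V _).
have Vx := (ultrafilter_setC _ UV).2 (npV x).
apply: filterS (filterI Vx IHs) => w [wx ws] /=.
by rewrite inE => /orP[/eqP|].
Qed.

(** * Ultrafilters on a subset *)

Section Pushforward.
Variables (T : Type) (D : set T).
Implicit Types (U : set_system D) (V : set_system T).

(** Ultrafilters on the complement of [S] are moved to the set of all places, where they can be
    compared with those of arbitrary primes. *)
Definition pushforward U : set_system T := [set Y | U (val @^-1` Y)].

Lemma ultrafilter_pushforward U : ultrafilter U -> ultrafilter (pushforward U).
Proof.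
move=> [UP UC]; split=> [|Y]; last exact: (UC (val @^-1` Y)).
exact: (fmap_proper_filter (val : D -> T) UP).
Qed.

Lemma pushforward_domain U : ultrafilter U -> pushforward U D.
Proof.
move=> [UP _]; rewrite /pushforward /=.
by apply: filterS (@filterT _ U _) => w _; apply: set_valP.
Qed.

Lemma pushforward_nonprincipal U w :
  nonprincipal_ultrafilter U -> ~ pushforward U [set w].
Proof.
move=> [UU npU]; rewrite /pushforward /= => Uw; apply: npU; have [UP _] := UU.
have [d /= dw] := filter_ex Uw; exists d; apply: ultrafilter_set1 => //.
by apply: filterS Uw => d' /= d'w; apply/val_inj/(etrans d'w).
Qed.

(** As [D] is in [V], a set belongs to [V] exactly when its part inside [D] does, so nothing is lost
    by restricting to [D]. *)
Lemma ultrafilter_trace V : ultrafilter V -> V D ->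
  exists2 U, ultrafilter U & pushforward U = V.
Proof.
move=> UV VD; have [VP VC] := UV.
pose U : set_system D := [set Y | V (val @` Y)].
have UE Y : U (val @^-1` Y) <-> V Y.
  rewrite /U /=; split=> VY; first by apply: filterS VY => _ [d Yd <-].
  apply: filterS (filterI VY VD) => w [Yw Dw].
  by exists (SigSub (mem_set Dw)).
exists U; last by apply/seteqP; split=> Y /UE.
have UC Y : U (~` Y) <-> V (~` (val @` Y)).
  rewrite -(UE (~` _)) /=; suff -> : val @^-1` (~` (val @` Y)) = ~` Y by [].
  apply/seteqP; split=> d /= nYd; first by move=> Yd; apply: nYd; exists d.
  by case=> d' Yd' /val_inj dd'; apply: nYd; rewrite -dd'.
split=> [|Y]; last by have [VY|VY] := VC (val @` Y); [left|right; apply/UC].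
split.
  by have := UE set0; rewrite preimage_set0 => /iffLR h /h; apply: filter_not_empty.
split=> [|P Q UP UQ|P Q PQ].
- by have := UE setT; rewrite preimage_setT => /iffRL; apply; apply: filterT.
- apply: (@filterS _ V) (@filterI _ V _ _ _ UP UQ) => _ [[d Pd <-] [d' Qd' /val_inj dd']].
  by exists d; split=> //; rewrite -dd'.
- by apply: (@filterS _ V) => _ [d Pd <-]; exists d => //; apply: PQ.
Qed.

End Pushforward.

(** * Idempotents and factorwise divisibility of adeles *)

Section Adeles.
Variables (R : realType) (K : fieldExtType rat).
Variable Kv : forall v : place R K, completion v.
Variables (S : set (place R K)) (archS : @archimedean_place R K `<=` S).

Local Notation A := (adele Kv archS).
Implicit Types (a b x y : A) (Y : set (place R K)) (p I J : set A).

Lemma adele_ext x y : (forall v, x v = y v) -> x = y.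
Proof. by move=> xy; apply/val_inj/functional_extensionality_dep. Qed.

Lemma adeleD x y v : (x + y) v = x v + y v. Proof. by []. Qed.
Lemma adeleM x y v : (x * y) v = x v * y v. Proof. by []. Qed.
Lemma adele0 v : (0 : A) v = 0. Proof. by []. Qed.

Lemma adeleX x n v : (x ^+ n) v = x v ^+ n.
Proof. by elim: n => [|n IHn]; rewrite ?expr0// !exprS adeleM IHn. Qed.

Lemma nonarchimedean v : ~ S v -> ~ archimedean_place v.
Proof. by move=> nSv /archS. Qed.

Lemma adele_factor x v : Defs.factor S (x v).
Proof. by case: x => f /= /asboolP. Qed.

Lemma adele_valring x v : ~ S v -> valring (Kv v) (x v).
Proof. by move=> nSv; case: (adele_factor x v). Qed.

Lemma factor1 v : Defs.factor S (1 : Kv v).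
Proof. exact: (adele_factor 1 v). Qed.

Lemma factor0 v : Defs.factor S (0 : Kv v).
Proof. exact: (adele_factor 0 v). Qed.

Lemma factorM v (s t : Kv v) : Defs.factor S s -> Defs.factor S t -> Defs.factor S (s * t).
Proof.
have [Sv|nSv] := pselect (S v); first by left.
have [_ _ hM] := valring_subring (Kv v) (nonarchimedean nSv).
by move=> [//|hs] [//|ht]; right; apply: hM.
Qed.

Lemma adele_choice (P : forall v, Kv v -> Prop) :
  (forall v, exists2 z, Defs.factor S z & P v z) -> exists x, forall v, P v (x v).
Proof.
move=> exz; pose f v := sval (cid2 (exz v)).
have fP v : Defs.factor S (f v) /\ P v (f v) by rewrite /f; case: (cid2 _).
exists (Adele archS (asboolT (fun v => proj1 (fP v)))) => v /=.
by have [] := fP v.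
Qed.

Lemma indicator_factor Y v : Defs.factor S (if `[< Y v >] then 1 else 0 : Kv v).
Proof. by case: `[< _ >]; [exact: factor1|exact: factor0]. Qed.

Definition idem Y : A := Adele archS (asboolT (indicator_factor Y)).

Lemma idem_in Y v : Y v -> idem Y v = 1.
Proof. by move=> Yv /=; rewrite asboolT. Qed.

Lemma idem_notin Y v : ~ Y v -> idem Y v = 0.
Proof. by move=> Yv /=; rewrite asboolF. Qed.

Lemma idem_setC Y x : x = idem Y * x + x * idem (~` Y).
Proof.
apply: adele_ext => v; rewrite adeleD !adeleM.
have [Yv|nYv] := pselect (Y v).
  by rewrite (idem_in Yv) (@idem_notin (~` Y)) ?mul1r ?mulr0 ?addr0//; apply.
by rewrite (idem_notin nYv) (@idem_in (~` Y)) ?mulr1 ?mul0r ?add0r.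
Qed.

(** Quotients may be chosen independently at each place; off [Y] the quotient is 0. *)
Lemma adele_dvd_on Y a b :
    (forall v, Y v -> exists2 z, Defs.factor S z & b v = a v * z) ->
  exists c, idem Y * b = a * c.
Proof.
move=> ab.
have [v|c cP] := @adele_choice (fun v z => idem Y v * b v = a v * z); last first.
  by exists c; apply: adele_ext => v; rewrite !adeleM cP.
have [Yv|nYv] := pselect (Y v).
  by have [z zS bE] := ab v Yv; exists z; rewrite // idem_in ?mul1r.
by exists 0; [exact: factor0|rewrite idem_notin// mul0r mulr0].
Qed.

Lemma adele_dvd a b :
  (forall v, exists2 z, Defs.factor S z & b v = a v * z) -> ideal_gen a b.
Proof.
move=> ab; have [v _|c cE] := @adele_dvd_on setT a b; first exact: ab.
exists c => //; rewrite mulrC -cE; apply: adele_ext => v.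
by rewrite adeleM idem_in ?mul1r.
Qed.

Lemma dvd_factor_unit v (s t : Kv v) : factor_unit S s -> Defs.factor S t ->
  exists2 z, Defs.factor S z & t = s * z.
Proof.
move=> [_ [u uS su]] tS; exists (u * t); first exact: factorM.
by rewrite mulrA su mul1r.
Qed.

Lemma factor_unit_S v (s : Kv v) : S v -> s <> 0 -> factor_unit S s.
Proof.
by move=> Sv s0; split; [left|exists s^-1; [left|rewrite mulfV//; apply/eqP]].
Qed.

Lemma factor_unit_valring v (s : Kv v) :
  ~ S v -> Defs.factor S s -> ~ valideal (Kv v) s -> factor_unit S s.
Proof.
move=> nSv [//|s1] /negP; rewrite /valring /valideal /= -leNgt => s2.
have cP := cabs_absval (Kv v); have sE : cabs s = 1 by apply/le_anti/andP.
split; first by right.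
exists s^-1; first by right; rewrite /valring /= (absvalV cP) sE invr1.
by rewrite mulfV// -(absval_eq0 cP) sE oner_neq0.
Qed.

(** In [b = idem Y * b + b * idem (~]
    Y)[the first term is a multiple of]a[and the second a multiple of]idem (~[Y)]. *)
Lemma ideal_dvd_on I Y a b : ideal I -> I (idem (~` Y)) -> I a ->
  (forall v, Y v -> exists2 z, Defs.factor S z & b v = a v * z) -> I b.
Proof.
move=> [_ ID IM] InY Ia /adele_dvd_on[c cE].
by rewrite (idem_setC Y b) cE mulrC; apply: ID; apply: IM.
Qed.

Lemma ideal_unit_on I Y a : ideal I -> I (idem (~` Y)) -> I a ->
  (forall v, Y v -> factor_unit S (a v)) -> I 1.
Proof.
move=> idI InY Ia aU; apply: (ideal_dvd_on idI InY Ia) => v /aU av.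
exact/dvd_factor_unit/factor1.
Qed.

(* A generator divides each [idem [set v]], so it is a unit at every place. *)
Lemma idem_set1_not_principal I :
  Defs.proper_ideal I -> (forall v, I (idem [set v])) -> ~ principal_ideal I.
Proof.
move=> [idI nI1] Iv [a IE]; apply: nI1; have [_ _ IM] := idI.
have Ia : I a by rewrite IE; exists 1; rewrite ?mul1r.
apply: (@ideal_unit_on I setT a) => // [|v _].
  have -> : idem (~` setT) = 0 * a; last exact: IM.
  by apply: adele_ext => v; rewrite mul0r idem_notin// => /(_ Logic.I).
have := Iv v; rewrite IE => -[r _ ra].
split; first exact: adele_factor.
exists (r v); first exact: adele_factor.
by rewrite mulrC -adeleM ra idem_in.
Qed.

Lemma prime_exp p x n : prime_ideal p -> p (x ^+ n) -> p x.
Proof.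
move=> [[_ np1] pM]; elim: n => [|n IHn]; first by rewrite expr0.
by rewrite exprS => /pM[].
Qed.

(** With [max_ideal], this treats single places and ultrafilters together: principal filters give
    [M0] and [Mm], pushforwards give [M0U] and [MmU]. *)
Definition zero_ideal (V : set_system (place R K)) : set A :=
  [set a | V [set v | a v = 0]].

Definition max_ideal (V : set_system (place R K)) : set A :=
  [set a | V [set v | valideal (Kv v) (a v)]].

(** * The minimal prime and the maximal ideal attached to an ultrafilter *)

Section UltrafilterIdeals.
Variable V : set_system (place R K).
Hypothesis UV : ultrafilter V.

#[local] Instance VP : ProperFilter V. Proof. by case: UV. Qed.

Lemma zero_ideal_idem Y : V Y -> zero_ideal V (idem (~` Y)).
Proof. by apply: filterS => v Yv; apply: idem_notin; apply. Qed.

Lemma zero_ideal_prime : prime_ideal (zero_ideal V).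
Proof.
split; [split; [split|]|] => [|x y Vx Vy|a x Vx|V1|x y Vxy].
- by apply: filterS (@filterT _ V _) => v _; exact: adele0.
- by apply: filterS (filterI Vx Vy) => v [xv yv]; rewrite /mkset adeleD xv yv addr0.
- by apply: filterS Vx => v xv; rewrite /mkset adeleM xv mulr0.
- by have [v /= /eqP] := filter_ex V1; rewrite oner_eq0.
- have [Vx|/(ultrafilter_setC _ UV) Vx] := pselect (zero_ideal V x); first by left.
  right; apply: filterS (filterI Vxy Vx) => v /= [/eqP xyv /eqP xv].
  by move: xyv; rewrite mulf_eq0 (negbTE xv) => /eqP.
Qed.

(** The product of [x] with the indicator of its zero set is 0, so a prime [J] contains one of the
    two. If the zero set is in [V], its indicator is outside [zero_ideal V], hence outside [J]. *)
Lemma zero_ideal_minimal : minimal_prime_ideal (zero_ideal V).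
Proof.
split=> [|J [[[J0 _ _] _] JM] JV]; first exact: zero_ideal_prime.
apply/seteqP; split=> // x Vx.
have /JM[//|/JV VnY] : J (x * idem [set v | x v = 0]).
  suff -> : x * idem [set v | x v = 0] = 0 by [].
  apply: adele_ext => v; have [xv|nxv] := pselect (x v = 0).
    by rewrite adeleM xv mul0r.
  by rewrite adeleM idem_notin// mulr0.
have [v [xv]] := filter_ex (filterI Vx VnY).
by rewrite /mkset idem_in// => /eqP; rewrite oner_eq0.
Qed.

Hypothesis VnS : V (~` S).

Lemma zero_ideal_sub_max : zero_ideal V `<=` max_ideal V.
Proof.
move=> x; apply: filterS => v /= xv.
by rewrite /valideal /= xv (absval0 (cabs_absval _)) ltr01.
Qed.

(** Everything is checked off [S], where the open unit ball is a prime ideal of the valuation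
    ring. *)
Lemma max_ideal_prime : prime_ideal (max_ideal V).
Proof.
split; [split; [split|]|] => [|x y Vx Vy|a x Vx|V1|x y Vxy].
- by apply: zero_ideal_sub_max; case: zero_ideal_prime => -[[]].
- apply: filterS (filterI VnS (filterI Vx Vy)) => v [nSv [xv yv]].
  apply: le_lt_trans (cabs_ultrametric (L:=Kv v) (nonarchimedean nSv) _ _) _.
  by rewrite gt_max xv yv.
- apply: filterS (filterI VnS Vx) => v [nSv xv].
  have cP := cabs_absval (Kv v); rewrite /valideal /= (absvalM cP).
  apply: le_lt_trans xv; rewrite ler_piMl ?(absval_ge0 cP)//.
  exact: (adele_valring a nSv).
- have [v] := filter_ex V1.
  by rewrite /= /valideal /= (absval1 (cabs_absval _)) ltxx.
- have [Vx|/(ultrafilter_setC _ UV) Vx] := pselect (max_ideal V x); first by left.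
  right; apply: filterS (filterI VnS (filterI Vxy Vx)) => v [nSv [xyv /negP nxv]].
  have cP := cabs_absval (Kv v); move: xyv nxv.
  rewrite /valideal /= (absvalM cP) -leNgt => xyv xv.
  by apply: le_lt_trans xyv; rewrite ler_peMl ?(absval_ge0 cP).
Qed.

(** An element outside [max_ideal V] is a unit at every place of some set in [V], which would put 1
    into [I]. *)
Lemma ideal_sub_max I : Defs.proper_ideal I ->
  (forall Y, V Y -> I (idem (~` Y))) -> I `<=` max_ideal V.
Proof.
move=> [idI nI1] VI x Ix; apply: contrapT => /(ultrafilter_setC _ UV) Vx.
apply: nI1; apply: (ideal_unit_on idI (VI _ (filterI Vx VnS)) Ix).
by move=> v /= [xv nSv]; apply: factor_unit_valring => //; apply: adele_factor.
Qed.

Lemma max_ideal_maximal : maximal_ideal (max_ideal V).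
Proof.
split=> [|J Jprop VJ]; first by case: max_ideal_prime.
apply/seteqP; split=> //; apply: ideal_sub_max => // Y VY.
exact/VJ/zero_ideal_sub_max/zero_ideal_idem.
Qed.

End UltrafilterIdeals.

(** * Ideals at a single place *)

Lemma M0E v0 : M0 Kv archS v0 = zero_ideal (principal_filter v0).
Proof.
by apply/seteqP; split=> x; [move=> ?; apply/principal_filterP|move/principal_filterP].
Qed.

Lemma MmE v0 : Mm Kv archS v0 = max_ideal (principal_filter v0).
Proof.
by apply/seteqP; split=> x; [move=> ?; apply/principal_filterP|move/principal_filterP].
Qed.

Lemma M0_minimal v0 : minimal_prime_ideal (M0 Kv archS v0).
Proof. by rewrite M0E; apply/zero_ideal_minimal/ultrafilter_principal. Qed.

Lemma Mm_maximal v0 : ~ S v0 -> maximal_ideal (Mm Kv archS v0).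
Proof.
move=> nSv0; rewrite MmE; apply: max_ideal_maximal.
  exact: ultrafilter_principal.
exact/principal_filterP.
Qed.

Lemma M0_idem v0 Y : Y v0 -> M0 Kv archS v0 (idem (~` Y)).
Proof. by move=> Yv0; apply: idem_notin; apply. Qed.

(** The factor at [v0] is a field, so an element of [I] that is nonzero there would be a unit
    there. *)
Lemma ideal_sub_M0 v0 I : S v0 -> Defs.proper_ideal I ->
  I (idem (~` [set v0])) -> I `<=` M0 Kv archS v0.
Proof.
move=> Sv0 [idI nI1] Iv0 x Ix; apply: contrapT => xv0; apply: nI1.
by apply: (ideal_unit_on idI Iv0 Ix) => _ ->; apply: factor_unit_S.
Qed.

Lemma M0_maximal v0 : S v0 -> maximal_ideal (M0 Kv archS v0).
Proof.
move=> Sv0; split=> [|J Jprop MJ]; first by case: (M0_minimal v0) => -[].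
by apply/seteqP; split=> //; apply: ideal_sub_M0 => //; apply/MJ/M0_idem.
Qed.

Lemma M0_not_maximal v0 : ~ S v0 -> ~ maximal_ideal (M0 Kv archS v0).
Proof.
move=> nSv0 [_ maxM0]; have cP := cabs_absval (Kv v0).
have [pi [pi0 pi1 _]] := local_field_uniformizer (Kv v0) (nonarchimedean nSv0).
have M0Mm : M0 Kv archS v0 `<=` Mm Kv archS v0.
  by move=> x; rewrite /Mm /M0 /= /valideal /= => ->; rewrite (absval0 cP) ltr01.
have /maxM0/(_ M0Mm) MmM0 : Defs.proper_ideal (Mm Kv archS v0).
  by case: (Mm_maximal nSv0).
(* An adele with a uniformizer at [v0] separates [Mm] from [M0]. *)
pose P v (z : Kv v) := v = v0 -> valideal (Kv v) z /\ z <> 0.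
have [v|x /(_ v0 erefl)[xv0 nxv0]] := @adele_choice P.
  have [->|vv0] := pselect (v = v0); last by exists 0; [exact: factor0|].
  by exists pi; [right; apply: ltW|split=> //; apply/eqP].
by apply: nxv0; have : Mm Kv archS v0 x := xv0; rewrite MmM0.
Qed.

Lemma M0_gen v0 a : a v0 = 0 -> (forall v, v <> v0 -> factor_unit S (a v)) ->
  M0 Kv archS v0 = ideal_gen a.
Proof.
move=> av0 aU; apply/seteqP; split=> [x xv0|_ [r _ <-]]; last first.
  by rewrite /M0 /mkset adeleM av0 mulr0.
apply: adele_dvd => v; have [->|vv0] := pselect (v = v0).
  by exists 0; [exact: factor0|rewrite av0 mul0r].
by apply: dvd_factor_unit; [exact: aU|exact: adele_factor].
Qed.

Lemma Mm_gen v0 a : ~ S v0 -> valideal_generator (a v0) ->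
  (forall v, v <> v0 -> factor_unit S (a v)) -> Mm Kv archS v0 = ideal_gen a.
Proof.
move=> nSv0 av0 aU; have [[[_ _ MmM] _] _] := Mm_maximal nSv0.
have Mma : Mm Kv archS v0 a.
  rewrite /Mm /mkset av0; exists 1; rewrite ?mulr1//.
  exact: (adele_valring 1 nSv0).
apply/seteqP; split=> [x xv0|_ [r _ <-]]; last exact: MmM.
apply: adele_dvd => v; have [->|vv0] := pselect (v = v0).
  by move: xv0; rewrite /Mm /mkset av0 => -[y yint <-]; exists y => //; right.
by apply: dvd_factor_unit; [exact: aU|exact: adele_factor].
Qed.

Lemma Mm_generator_exists v0 : ~ S v0 -> exists a : A,
  valideal_generator (a v0) /\ (forall v, v <> v0 -> factor_unit S (a v)).
Proof.
move=> nSv0; have [pi piE] := valideal_generator_exists (Kv v0) (nonarchimedean nSv0).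
have piS : Defs.factor S pi.
  right; apply: ltW; suff : valideal (Kv v0) pi by [].
  rewrite piE; exists 1; rewrite ?mulr1//; exact: (adele_valring 1 nSv0).
pose P v (z : Kv v) :=
  (v = v0 -> valideal_generator z) /\ (v <> v0 -> factor_unit S z).
have [v|a aP] := @adele_choice P; last first.
  by exists a; split=> [|v]; [apply: (aP v0).1|apply: (aP v).2].
have [->|vv0] := pselect (v = v0); first by exists pi.
exists 1; first exact: factor1.
split=> // _; split; first exact: factor1.
by exists 1; rewrite ?mulr1//; apply: factor1.
Qed.

(* As [|x| < 1] at [v0], some power of [x] is divisible by [a] there. *)
Lemma prime_at_place v0 p : ~ S v0 -> prime_ideal p ->
    p (idem (~` [set v0])) -> p `<=` Mm Kv archS v0 ->
  p = M0 Kv archS v0 \/ p = Mm Kv archS v0.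
Proof.
move=> nSv0 pP pv0 pMm; have cP := cabs_absval (Kv v0).
have [pM0|npM0] := pselect (p `<=` M0 Kv archS v0).
  by left; apply: (M0_minimal v0).2.
right; apply/seteqP; split=> // x xv0.
have /existsNP[a /not_implyP[pa /eqP av0]] := npM0.
have [n xn] : exists n, cabs (x v0) ^+ n <= cabs (a v0).
  have [pi [pi0 pi1 pimax]] := local_field_uniformizer (Kv v0) (nonarchimedean nSv0).
  have := local_field_value_group pi0 pi1 pimax av0.
  (* If [|a v0| = |pi| ^ n], then [|x v0| <= |pi|] makes [n] work; a negative exponent gives
     [|a v0| >= 1], and the power 0 works. *)
  case=> -[n|n] ->; [exists n|exists 0; rewrite expr0 NegzE -exprnN].
    by apply: lerXn2r; rewrite ?nnegrE ?(absval_ge0 cP)//; apply: pimax.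
  by rewrite invf_ge1 ?exprn_ile1 ?exprn_gt0 ?(absval_gt0 cP) ?(absval_ge0 cP)// ltW.
apply: (prime_exp (n := n) pP); apply: (ideal_dvd_on pP.1.1 pv0 pa) => _ ->.
rewrite adeleX; exists (x v0 ^+ n / a v0); last by rewrite mulrCA mulfV ?mulr1.
right; rewrite /valring /= (absvalM cP) (absvalV cP) (absvalX cP).
by rewrite ler_pdivrMr ?mul1r// (absval_gt0 cP).
Qed.

(** * The ultrafilter of a prime ideal and the unlisted primes *)

Definition prime_filter p : set_system (place R K) := [set Y | p (idem (~` Y))].

Lemma prime_filter_ultrafilter p : prime_ideal p -> ultrafilter (prime_filter p).
Proof.
move=> [[idp np1] pM]; have [p0 pD pMl] := idp.
have subP (Y Z : set (place R K)) : Y `<=` Z -> p (idem Z) -> p (idem Y).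
  move=> YZ pZ; suff -> : idem Y = idem Y * idem Z by apply: pMl.
  apply: adele_ext => v; rewrite adeleM; have [Yv|nYv] := pselect (Y v).
    by rewrite !idem_in ?mulr1//; apply: YZ.
  by rewrite idem_notin// mul0r.
have idemD (Y : set (place R K)) : idem Y + idem (~` Y) = 1.
  by rewrite {1}(idem_setC Y 1) mulr1 mul1r.
have p_idem0 (Y : set (place R K)) : p (idem Y * idem (~` Y)).
  suff -> : idem Y * idem (~` Y) = 0 by [].
  apply: adele_ext => v; rewrite adeleM; have [Yv|nYv] := pselect (Y v).
    by rewrite (@idem_notin (~` Y)) ?mulr0//; apply.
  by rewrite idem_notin// mul0r.
split; last first.
  by move=> Y; rewrite /prime_filter /= setCK; have [|] := pM _ _ (p_idem0 Y); [right|left].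
split=> [|]; rewrite /prime_filter /=.
  rewrite setC0 => pT; apply: np1; suff -> : 1 = idem setT by [].
  by apply: adele_ext => v; rewrite idem_in.
split=> [|Y Z pY pZ|Y Z YZ]; rewrite /prime_filter /=.
- rewrite setCT; suff -> : idem set0 = 0 by [].
  by apply: adele_ext => v; rewrite idem_notin.
- rewrite setCI.
  suff -> : idem (~` Y `|` ~` Z) = idem (~` Y) + idem Y * idem (~` Z).
    by apply: pD => //; apply: pMl.
  apply: adele_ext => v; rewrite adeleD adeleM.
  have [Yv|nYv] := pselect (Y v); last first.
    by rewrite (idem_notin nYv) mul0r addr0 !idem_in//; left.
  rewrite (idem_in Yv) mul1r (@idem_notin (~` Y)) ?add0r; last exact.
  have [Zv|nZv] := pselect (Z v); last by rewrite !idem_in//; right.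
  by rewrite !idem_notin//; case; apply.
- by apply: subP; apply: subsetC.
Qed.

(** Otherwise [p] would contain [M0] at [v] and come from a prime of the factor at [v], and all of
    these are listed. *)
Lemma unlisted_prime_filter p v : prime_ideal p -> ~ listed_prime p ->
  ~ prime_filter p [set v].
Proof.
move=> pP np pv; apply: np; have M0p : M0 Kv archS v `<=` p.
  move=> x xv; apply: (ideal_dvd_on pP.1.1 pv (a := 0)); first by case: pP.1.1.
  by move=> _ ->; exists 0; [exact: factor0|rewrite mulr0].
have [Sv|nSv] := pselect (S v).
  apply: Or31; exists v; apply/seteqP; split=> //; apply: ideal_sub_M0 => //.
  exact: pP.1.
have pMm : p `<=` Mm Kv archS v.
  rewrite MmE; apply: ideal_sub_max => //.
  - exact: ultrafilter_principal.
  - exact/principal_filterP.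
  - exact: pP.1.
  - by move=> Y /principal_filterP Yv; apply/M0p/M0_idem.
have [->|->] := prime_at_place nSv pP pv pMm; first by apply: Or31; exists v.
by apply: Or32; exists v.
Qed.

(** One inclusion takes [b = a] and [n = 1]. For the other, [b] divides [a ^+ n] on a set of the
    ultrafilter, so [a ^+ n] is in [p], and primality removes the exponent. *)
Lemma prime_eq_bigcup_p_beta (U : set_system (~` S)) p :
    ProperFilter U -> prime_ideal p -> pushforward U = prime_filter p ->
  p = \bigcup_(b in p) p_beta U b.
Proof.
move=> UP pP UE; apply/seteqP; split=> [a pa|a [b pb [Y UY [n _ ab]]]].
  by exists a => //; exists setT; [exact: filterT|exists 1 => // v _; rewrite expr1].
have pY : p (idem (~` (val @` Y))).
  have : pushforward U (val @` Y).
    by rewrite /pushforward /=; apply: filterS UY => v Yv; exists v.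
  by rewrite UE.
apply: (prime_exp (n := n) pP); apply: (ideal_dvd_on pP.1.1 pY pb) => _ [v Yv <-].
have nSv : ~ S (val v) := set_valP v.
have [z z1 zE] := (normval_le (nonarchimedean nSv) _ _).1 (ab v Yv).
by exists z; [right|rewrite adeleX].
Qed.

Lemma unlisted_prime p : finite_set S -> prime_ideal p -> ~ listed_prime p ->
  (exists U : set_system (~` S),
    [/\ nonprincipal_ultrafilter U,
        p `<=` MmU Kv archS U,
        forall U' : set_system (~` S), nonprincipal_ultrafilter U' ->
          p `<=` MmU Kv archS U' -> U' = U &
        p = \bigcup_(b in p) p_beta U b]) /\
  ~ principal_ideal p.
Proof.
move=> finS pP np; have UV := prime_filter_ultrafilter pP.
have npV v : ~ prime_filter p [set v] by apply: unlisted_prime_filter.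
split; last first.
  apply: idem_set1_not_principal => [|v]; first exact: pP.1.
  by have /(ultrafilter_setC _ UV) := npV v; rewrite /prime_filter /= setCK.
have VnS := ultrafilter_finite UV npV finS.
have [U UU UE] := ultrafilter_trace UV VnS; exists U; have [UP _] := UU.
split.
- split=> // -[w Uw]; apply: (npV (val w)); rewrite -UE /pushforward /= Uw.
  exact/principal_filterP.
- have : p `<=` max_ideal (prime_filter p) by apply: ideal_sub_max => //; exact: pP.1.
  by rewrite -UE.
(* For [Y] in [U], the indicator of the complement of [Y] is in [p], hence in [MmU] of [U']. It is 1
   off [Y], so [Y] is in [U']. *)
- move=> U' [UU' npU'] pU'; apply/esym/ultrafilter_sub_eq => // Y UY.
  have [UP' _] := UU'.
  have /pU' : p (idem (~` (val @` Y))).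
    have : pushforward U (val @` Y).
      by rewrite /pushforward /=; apply: filterS UY => v Yv; exists v.
    by rewrite UE.
  apply: filterS => v; have [//|nYv] := pselect (Y v); rewrite /mkset idem_in.
    by rewrite /valideal /= (absval1 (cabs_absval _)) ltxx.
  by case=> v' Yv' /val_inj vv'; apply: nYv; rewrite -vv'.
- exact: prime_eq_bigcup_p_beta.
Qed.

End Adeles.

(** * Assembly of the classification *)

Theorem theorem2p2 (R : realType) (K : fieldExtType rat)
    (Kv : forall v : place R K, completion v)
    (S : set (place R K)) (finS : finite_set S)
    (archS : archimedean_place `<=` S) :
  [/\
      forall v0 : place R K,
      [/\ prime_ideal (M0 Kv archS v0),
          S v0 -> maximal_ideal (M0 Kv archS v0) /\
                  minimal_prime_ideal (M0 Kv archS v0),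
          ~ S v0 -> minimal_prime_ideal (M0 Kv archS v0) /\
                    ~ maximal_ideal (M0 Kv archS v0),
          exists a : adele Kv archS, a v0 = 0 /\
            (forall v, v <> v0 -> factor_unit S (a v)) &
          forall a : adele Kv archS, a v0 = 0 ->
            (forall v, v <> v0 -> factor_unit S (a v)) ->
            M0 Kv archS v0 = ideal_gen a],
      forall v0 : place R K, ~ S v0 ->
      [/\ prime_ideal (Mm Kv archS v0),
          maximal_ideal (Mm Kv archS v0),
          exists a : adele Kv archS, valideal_generator (a v0) /\
            (forall v, v <> v0 -> factor_unit S (a v)) &
          forall a : adele Kv archS, valideal_generator (a v0) ->
            (forall v, v <> v0 -> factor_unit S (a v)) ->
            Mm Kv archS v0 = ideal_gen a],
      forall U : set_system (~` S), nonprincipal_ultrafilter U ->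
      [/\ prime_ideal (MmU Kv archS U) /\ maximal_ideal (MmU Kv archS U),
          minimal_prime_ideal (M0U Kv archS U),
          ~ principal_ideal (MmU Kv archS U) &
          ~ principal_ideal (M0U Kv archS U)] &
      forall p : set (adele Kv archS), prime_ideal p -> ~ listed_prime p ->
      (exists U : set_system (~` S),
        [/\ nonprincipal_ultrafilter U,
            p `<=` MmU Kv archS U,
            forall U' : set_system (~` S), nonprincipal_ultrafilter U' ->
              p `<=` MmU Kv archS U' -> U' = U &
            p = \bigcup_(b in p) p_beta U b]) /\
      ~ principal_ideal p].
Proof.
split=> [v0|v0 nSv0|U npU|p pP np].
- split.
  + by case: (M0_minimal Kv archS v0).
  + by move=> Sv0; split; [exact: M0_maximal|exact: M0_minimal].
  + by move=> nSv0; split; [exact: M0_minimal|exact: M0_not_maximal].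
  + exists (idem Kv archS (~` [set v0])); split; first by rewrite idem_notin//; apply.
    move=> v vv0; rewrite idem_in//; split; first exact: factor1.
    by exists 1; [exact: factor1|rewrite mulr1].
  + exact: M0_gen.
- split.
  + rewrite MmE; apply: max_ideal_prime; first exact: ultrafilter_principal.
    exact/principal_filterP.
  + exact: Mm_maximal.
  + exact: Mm_generator_exists.
  + by move=> a; apply: Mm_gen.
(* [MmU] and [M0U] are by conversion [max_ideal] and [zero_ideal] of the pushforward of [U]. *)
- have UV := ultrafilter_pushforward npU.1; have VnS := pushforward_domain npU.1.
  have idem_set1 v : zero_ideal (pushforward U) (idem Kv archS [set v]).
    rewrite -[[set v]]setCK; apply: zero_ideal_idem => //.
    exact/(ultrafilter_setC _ UV)/pushforward_nonprincipal.
  have max_prime := max_ideal_prime Kv archS UV VnS.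
  have zero_min := zero_ideal_minimal Kv archS UV.
  split=> //.
  + by split=> //; exact: (max_ideal_maximal Kv archS UV VnS).
  + apply: (idem_set1_not_principal max_prime.1) => v.
    exact: zero_ideal_sub_max.
  + exact: (idem_set1_not_principal zero_min.1.1).
- exact: unlisted_prime.
Qed.
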